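(* Let $P$ be a finite poset having a unique minimum element $\widehat{0}$ and a rank function $\rho:P\to\mathbb{N}$ satisfying $\rho(\widehat{0})=0$, and let $n=\max\{\rho(p):p\in P\}$. Then $$ \operatorname{t}(P,x)=\sum_{S\subseteq[1,n]} f_S(P)\cdot \sum_{\substack{\lambda\in\{-1,1\}^n:\\ S(\lambda)\supseteq S,\ n-2i_{\lambda}\geq 0}} (-1)^{n-i_{\lambda}+|S|}x^{n-2i_{\lambda}}. $$
   Context: A rank function satisfies $\rho(y)=\rho(x)+1$ whenever $y$ covers $x$. $[1,n]=\{1,\dots,n\}$, and $[\widehat{0},p)=\{q\in P:q<p\}$. For $S\subseteq[1,n]$, $f_S(P)$ is the number of maximal chains in the $S$ rank-selected subposet $P_S=\{u\in P:\rho(u)\in S\}$. For $\lambda=(\lambda_1,\dots,\lambda_n)\in\{-1,1\}^n$, $S(\lambda)=\{s\in[1,n]:\lambda_1+\cdots+\lambda_s>0\}$ and $i_\lambda$ is the number of $-1$'s in $\lambda$. For $z\in\mathbb{Z}$, $U_{\geq z}$ is the linear operator on Laurent polynomials in $x$ discarding all terms of degree less than $z$. The short toric polynomial $\operatorname{t}(P,x)$ is defined for all finite posets $P$ having a unique minimum element $\widehat{0}$ and a rank function $\rho:P\to\mathbb{N}$ with $\rho(\widehat{0})=0$ (and for the empty poset) recursively by $\operatorname{t}(\emptyset,x)=1$ and $$ \operatorname{t}(P,x)=U_{\geq 0}\left((x^{-1}-x)^{n} +\sum_{p\in P\setminus\{\widehat{0}\}} U_{\geq 1}\left(\operatorname{t}([\widehat{0},p),x)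 (x-x^{-1})\right)(x^{-1}-x)^{n-\rho(p)}\right), $$ where $n=\max\{\rho(p):p\in P\}$.
   Formalization: f_S(P) counts only those maximal chains of P_S that contain an element of every rank in S; with all inclusion-maximal chains the formula fails when maximal elements of P have different ranks, e.g. P={0<a<b, 0<c}. The two counts agree when all maximal elements have rank n. *)

(* Defs.v *)
From HB Require Import structures.
From mathcomp Require Import all_boot all_order all_algebra.
From mathcomp Require Import finmap.
From mathcomp.multinomials Require Import monalg.

Set Implicit Arguments.
Unset Strict Implicit.
Unset Printing Implicit Defensive.

Import Order.TTheory GRing.Theory Num.Theory.

Local Open Scope ring_scope.

(* Laurent polynomials in one variable x with integer coefficients, as the
   group ring Z[Z]: [<< c *g k >>] is the term c x^k and [g@_k] the coefficient
   of x^k in g.  The ring structure of monalg.v does not apply here, because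
   its monoids of exponents have no invertible element but the neutral one. *)
Definition laurent : Type := {malg int[int]}.

HB.instance Definition _ := GRing.Zmodule.on laurent.

Definition laurent_mul (g1 g2 : laurent) : laurent :=
  \sum_(k1 <- msupp g1) \sum_(k2 <- msupp g2)
    << g1@_k1 * g2@_k2 *g (k1 + k2)%R >>.

Definition xpow (k : int) : laurent := << 1 *g k >>.

Section LaurentRing.

Local Open Scope fset_scope.
Local Open Scope ring_scope.

Implicit Types (g : laurent) (k : int).

Lemma laurent_mulEw (d1 d2 : {fset int}) g1 g2 :
  msupp g1 `<=` d1 -> msupp g2 `<=` d2 ->
  laurent_mul g1 g2 =
  \sum_(k1 <- d1) \sum_(k2 <- d2) << g1@_k1 * g2@_k2 *g (k1 + k2)%R >>.
Proof.
move=> le_d1 le_d2; rewrite /laurent_mul (big_fset_incl _ le_d1) /=.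
  apply/eq_bigr=> k1 _; apply/big_fset_incl => // k _ /mcoeff_outdom ->.
  by rewrite mulr0 monalgU0.
move=> k _ /mcoeff_outdom g1k.
by rewrite big1 => // k' _; rewrite g1k mul0r monalgU0.
Qed.

Lemma laurent_mulC : commutative laurent_mul.
Proof.
move=> g1 g2; rewrite /laurent_mul exchange_big /=.
apply/eq_bigr=> k1 _; apply/eq_bigr=> k2 _.
by rewrite mulrC addrC.
Qed.

Lemma laurent_mul0 : left_zero (0 : laurent) laurent_mul.
Proof. by move=> g; rewrite /laurent_mul msupp0 big_seq_fset0. Qed.

Lemma laurent_mulDl : left_distributive laurent_mul +%R.
Proof.
move=> g1 g2 g.
rewrite [in RHS](laurent_mulEw (fsubsetUl _ (msupp g2)) (fsubset_refl _)).
rewrite [in RHS](laurent_mulEw (fsubsetUr (msupp g1) _) (fsubset_refl _)).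
rewrite (laurent_mulEw (msuppD_le _ _) (fsubset_refl _)).
rewrite -big_split /=; apply/eq_bigr=> k1 _.
rewrite -big_split /=; apply/eq_bigr=> k2 _.
by rewrite mcoeffD mulrDl monalgUD.
Qed.

Lemma laurent_mulUU (c1 c2 k1 k2 : int) :
  laurent_mul << c1 *g k1 >> << c2 *g k2 >> = << c1 * c2 *g (k1 + k2)%R >>.
Proof.
by rewrite (laurent_mulEw msuppU_le msuppU_le) !big_seq_fset1 !mcoeffUU.
Qed.

Lemma laurent_mul1 : left_id (xpow 0) laurent_mul.
Proof.
move=> g; rewrite (laurent_mulEw msuppU_le (fsubset_refl _)) big_seq_fset1.
rewrite [RHS]monalgE; apply/eq_bigr=> k _.
by rewrite mcoeffUU mul1r add0r.
Qed.

Lemma laurent_mulA : associative laurent_mul.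
Proof.
have suml (s : seq int) (F : int -> laurent) g :
    laurent_mul (\sum_(k <- s) F k) g = \sum_(k <- s) laurent_mul (F k) g.
  exact: (big_morph (laurent_mul^~ g) (fun _ _ => laurent_mulDl _ _ _)
            (laurent_mul0 g)).
have sumr (s : seq int) (F : int -> laurent) g :
    laurent_mul g (\sum_(k <- s) F k) = \sum_(k <- s) laurent_mul g (F k).
  by rewrite laurent_mulC suml; apply: eq_bigr => k _; rewrite laurent_mulC.
move: laurent_mulUU suml sumr; move: laurent_mul => m mUU suml sumr g1 g2 g3.
rewrite (monalgE g1) !suml; apply/eq_bigr=> k1 _.
rewrite (monalgE g2) sumr !suml sumr; apply/eq_bigr=> k2 _.
rewrite (monalgE g3) !sumr; apply/eq_bigr=> k3 _.
by rewrite !mUU mulrA addrA.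
Qed.

Lemma laurent_1neq0 : xpow 0 != 0.
Proof. by rewrite monalgU_eq0 oner_eq0. Qed.

End LaurentRing.

HB.instance Definition _ := GRing.Zmodule_isComNzRing.Build laurent
  laurent_mulA laurent_mulC laurent_mul1 laurent_mulDl laurent_1neq0.

Arguments laurent_mul : simpl never.
Arguments xpow : simpl never.

Lemma xpow0 : xpow 0 = 1.
Proof. by []. Qed.

Lemma xpowD (k l : int) : xpow (k + l) = xpow k * xpow l.
Proof. by rewrite [RHS]laurent_mulUU mulr1. Qed.

(* The operator U_{>= z}. *)
Definition Ugeq (z : int) (g : laurent) : laurent :=
  \sum_(k <- msupp g | z <= k) << g@_k *g k >>.

Arguments Ugeq : simpl never.

Lemma Ugeq_coeff (z : int) (g : laurent) (k : int) :
  (Ugeq z g)@_k = if z <= k then g@_k else 0.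
Proof.
rewrite /Ugeq big_mkcond raddf_sum /= (big_fset_incl _ (fsubsetUl _ [fset k]%fset)) /=.
  rewrite (big_fsetD1 k) /=; last by rewrite !inE eqxx orbT.
  rewrite big1_fset ?addr0 => [|l]; last first.
    rewrite !inE => /andP[/negbTE nlk _] _.
    by case: ifP; rewrite ?mcoeff0 // mcoeffU nlk.
  by case: ifP; rewrite ?mcoeff0 ?mcoeffUU.
move=> l _ /mcoeff_outdom ->.
by rewrite monalgU0 if_same mcoeff0.
Qed.

Lemma UgeqB (z : int) : {morph Ugeq z : g h / g - h}.
Proof.
move=> g h; apply/malgP => k.
rewrite mcoeffB !Ugeq_coeff mcoeffB.
by case: ifP; rewrite ?subr0.
Qed.

Section RankedPosets.

Context {d : Order.disp_t} {P : finBPOrderType d}.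

Definition covers (x y : P) : bool :=
  (x < y)%O && [forall z, ~~ ((x < z)%O && (z < y)%O)].

Definition rank_function (rho : P -> nat) : Prop :=
  forall x y : P, covers x y -> rho y = (rho x).+1.

(* The short toric polynomial of the subposet A of P, meant for A empty or
   containing \bot, and with the rank function of A induced by rho, as is the
   case for the subposets [\bot, p).  The first argument bounds the depth of
   the recursion: see short_toric0 and short_toricE. *)
Fixpoint short_toric_rec (k : nat) (rho : P -> nat) (A : {set P}) : laurent :=
  if k is k'.+1 then
    if A == set0 then 1 else
    let n := (\max_(p in A) rho p)%N in
    Ugeq 0 ((xpow (-1) - xpow 1) ^+ n
      + \sum_(p in A :\ \bot%O)
          Ugeq 1 (short_toric_rec k' rho [set q in A | (q < p)%O]
                    * (xpow 1 - xpow (-1)))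
          * (xpow (-1) - xpow 1) ^+ (n - rho p))
  else 1.

Definition short_toric (rho : P -> nat) (A : {set P}) : laurent :=
  short_toric_rec #|A| rho A.

Lemma short_toric_rec_stable (rho : P -> nat) (k : nat) (A : {set P}) :
  (#|A| <= k)%N -> short_toric_rec k rho A = short_toric rho A.
Proof.
have rec0 (j : nat) : short_toric_rec j rho set0 = 1.
  by case: j => [|j] /=; rewrite ?eqxx.
have card_lt (B : {set P}) (p : P) : p \in B :\ \bot%O ->
    (#|[set q in B | (q < p)%O]| < #|B|)%N.
  rewrite in_setD1 => /andP[_ pB]; apply: proper_card; apply/properP; split.
    by apply/subsetP => q; rewrite inE => /andP[].
  by exists p => //; rewrite inE ltxx andbF.
suff H m : forall (j l : nat) (B : {set P}), (#|B| <= m)%N -> (#|B| <= j)%N ->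
    (#|B| <= l)%N -> short_toric_rec j rho B = short_toric_rec l rho B.
  by move=> Ak; apply: (H #|A|).
elim: m => [|m IHm] j l B.
  rewrite leqn0 cards_eq0 => /eqP -> _ _.
  by rewrite !rec0.
case: j => [|j] Bm.
  rewrite leqn0 cards_eq0 => /eqP -> _.
  by rewrite !rec0.
case: l => [|l] Bj.
  by rewrite leqn0 cards_eq0 => /eqP ->; rewrite !rec0.
move=> Bl; have [->|Bn0] := eqVneq B set0; first by rewrite !rec0.
rewrite /= (negbTE Bn0); apply: (f_equal (fun g => Ugeq 0 (_ + g))).
apply: eq_bigr => p /card_lt ltB.
apply: (f_equal (fun g => Ugeq 1 (g * _) * _)).
by apply: IHm; rewrite -ltnS; exact: leq_trans ltB _.
Qed.

Lemma short_toric0 (rho : P -> nat) : short_toric rho set0 = 1.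
Proof. by rewrite /short_toric cards0. Qed.

Lemma short_toricE (rho : P -> nat) (A : {set P}) : A != set0 ->
  let n := (\max_(p in A) rho p)%N in
  short_toric rho A =
  Ugeq 0 ((xpow (-1) - xpow 1) ^+ n
    + \sum_(p in A :\ \bot%O)
        Ugeq 1 (short_toric rho [set q in A | (q < p)%O]
                  * (xpow 1 - xpow (-1)))
        * (xpow (-1) - xpow 1) ^+ (n - rho p)).
Proof.
move=> An0; rewrite -(@short_toric_rec_stable rho #|A|.+1) ?leqnSn // /=.
rewrite (negbTE An0); apply: (f_equal (fun g => Ugeq 0 (_ + g))).
apply: eq_bigr => p _; apply: (f_equal (fun g => Ugeq 1 (g * _) * _)).
apply: short_toric_rec_stable.
by apply: subset_leq_card; apply/subsetP => q; rewrite inE => /andP[].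
Qed.

Definition rank_selected (rho : P -> nat) (n : nat) (S : {set 'I_n.+1}) :
    {set P} :=
  [set u | [exists s in S, rho u == s]].

Definition is_chain (C : {set P}) : bool :=
  [forall x in C, forall y in C, (x >=< y)%O].

Definition maximal_chain (Q C : {set P}) : bool :=
  maxset [pred D : {set P} | (D \subset Q) && is_chain D] C.

(* The number of maximal chains of the rank-selected subposet P_S.  Such a
   chain is required to meet every rank in S; this is automatic when all
   maximal elements of P have the same rank (see flag_f_pure), but when they
   do not, an inclusion-maximal chain of P_S may miss some ranks of S, and
   these chains are not counted. *)
Definition flag_f (rho : P -> nat) (n : nat) (S : {set 'I_n.+1}) : nat :=
  #|[set C : {set P} | maximal_chain (rank_selected rho S) C
      && [forall s in S, exists u in C, rho u == s]]|.

Lemma exists_cover (x y : P) : (x < y)%O -> exists2 z, covers x z & (z <= y)%O.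
Proof.
move=> xy; have y0 : (x < y)%O && (y <= y)%O by rewrite xy lexx.
case: (@arg_minnP _ y (fun z => (x < z)%O && (z <= y)%O)
         (fun z => #|[set w | (w < z)%O]|) y0) => z /andP[xz zy] zmin.
exists z => //; rewrite /covers xz; apply/forallP => w.
apply/negP => /andP[xw wz].
have := zmin w; rewrite xw (le_trans (ltW wz) zy) => /(_ isT).
rewrite leqNgt => /negP; apply; apply: proper_card; apply/properP; split.
  by apply/subsetP => v; rewrite !inE => /lt_trans; apply.
by exists w; rewrite !inE ?wz // ltxx.
Qed.

Lemma rank_lt (rho : P -> nat) (x y : P) :
  rank_function rho -> (x < y)%O -> (rho x < rho y)%N.
Proof.
move=> hrho; move: {2}#|_| (leqnn #|[set w | (x < w)%O]|) => m.
elim: m x => [|m IHm] x.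
  rewrite leqn0 cards_eq0 => /eqP/setP/(_ y); rewrite !inE => -> //.
move=> xm xy; have [z xz zy] := exists_cover xy.
rewrite -(hrho _ _ xz); move: zy; rewrite le_eqVlt => /predU1P[-> //|zy].
apply: ltnW; apply: IHm zy; rewrite -ltnS; apply: leq_trans xm.
have /andP[ltxz _] := xz.
apply: proper_card; apply/properP; split.
  by apply/subsetP => v; rewrite !inE; exact: lt_trans.
by exists z; rewrite !inE ?ltxx.
Qed.

Lemma rank_between (rho : P -> nat) (x y : P) (r : nat) :
    rank_function rho -> (x <= y)%O -> (rho x <= r <= rho y)%N ->
  exists2 z, (x <= z <= y)%O & rho z = r.
Proof.
move=> hrho; move Ek : (r - rho x)%N => k; elim: k x Ek => [|k IHk] x Ek xy.
  move=> /andP[xr ry]; exists x; first by rewrite lexx.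
  by apply/eqP; rewrite eqn_leq xr -subn_eq0 Ek.
move=> /andP[xr ry]; have ltxr : (rho x < r)%N by rewrite -subn_gt0 Ek.
have ltxy : (x < y)%O.
  rewrite lt_neqAle xy andbT; apply/eqP => exy.
  by move: ry; rewrite -exy leqNgt ltxr.
have [w xw wy] := exists_cover ltxy.
have rw := hrho _ _ xw; have /andP[ltxw _] := xw.
have [||z /andP[wz zy] rz] := IHk w _ wy; first by rewrite rw subnS Ek.
  by rewrite rw ltxr.
by exists z; rewrite // zy (le_trans (ltW ltxw)).
Qed.

Lemma flag_f_pure (rho : P -> nat) (n : nat) (S : {set 'I_n.+1}) :
    rank_function rho -> rho \bot%O = 0%N ->
    (forall x : P, (forall y, ~~ (x < y)%O) -> rho x = n) ->
  flag_f rho S =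
  #|[set C : {set P} | maximal_chain (rank_selected rho S) C]|.
Proof.
move=> hrho rho0 pureP; apply: eq_card => C; rewrite !inE.
case: (boolP (maximal_chain _ C)) => //= /maxsetP[/andP[CQ /forall_inP chC] Cmax].
have cmp u v : u \in C -> v \in C -> (u >=< v)%O by move=> uC; move/forall_inP: (chC _ uC); apply.
apply/forall_inP => s sS; apply/exists_inP.
case: (boolP [exists u in C, rho u == s]) => [/exists_inP //|/exists_inPn Cs].
have b0 : ((\bot%O \in C) || (\bot%O == \bot%O :> P)) && (rho \bot%O <= s)%N.
  by rewrite eqxx orbT rho0.
case: (@arg_maxnP _ (\bot%O : P)
         (fun x => ((x \in C) || (x == \bot%O)) && (rho x <= s)%N) rho b0)
  => x /andP[xC xs] xmax.
have cmpx u : u \in C -> (u >=< x)%O.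
  move=> uC; case/orP: xC => [xC|/eqP ->]; first exact: cmp.
  by rewrite /Order.comparable le0x orbT.
have [y [xy sy ymin]] : exists y, [/\ (x <= y)%O, (s <= rho y)%N &
    forall u, u \in C -> (s < rho u)%N -> (y <= u)%O].
  case: (pickP [pred u | (u \in C) && (s < rho u)%N]) => [u0 u0P | none].
    case: (@arg_minnP _ u0 (fun u => (u \in C) && (s < rho u)%N) rho u0P)
      => y /andP[yC sy] ymin.
    exists y; split; [|exact: ltnW|].
      have := cmpx _ yC; rewrite comparable_sym => /comparable_leP[//|yx].
      by have := rank_lt hrho yx; rewrite ltnNge (leq_trans xs (ltnW sy)).
    move=> u uC su; have := cmp _ _ yC uC => /comparable_leP[//|uy].
    have := ymin u; rewrite uC su => /(_ isT).
    by rewrite leqNgt (rank_lt hrho uy).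
  have x0 : (x <= x)%O by [].
  case: (@arg_maxnP _ x (fun y => (x <= y)%O) rho x0) => y xy ymax.
  exists y; split=> // [|u uC su]; last by have := none u; rewrite /= uC su.
  rewrite (pureP y); first by rewrite -ltnS ltn_ord.
  move=> w; apply/negP => yw.
  have /= := ymax w (le_trans xy (ltW yw)).
  by rewrite leqNgt (rank_lt hrho yw).
have [|z /andP[xz zy] rz] := rank_between (r := s) hrho xy; first by rewrite xs.
have cmpz u : u \in C -> (z >=< u)%O.
  move=> uC; have := Cs u uC; rewrite neq_ltn => /orP[us|su]; last first.
    by rewrite /Order.comparable (le_trans zy (ymin u uC su)).
  rewrite /Order.comparable; apply/orP; right; apply: le_trans xz.
  have := cmpx _ uC => /comparable_leP[//|xu].
  have := xmax u; rewrite uC (ltnW us) => /(_ isT) /=.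
  by rewrite leqNgt (rank_lt hrho xu).
have zC : z |: C = C.
  apply: Cmax; last exact: subsetUr.
  apply/andP; split.
    apply/subsetP => u; rewrite in_setU1 => /predU1P[->|]; last exact/subsetP.
    by rewrite inE; apply/exists_inP; exists s; rewrite ?rz.
  apply/forall_inP => u; rewrite in_setU1 => /predU1P[->|uC];
  apply/forall_inP => v; rewrite in_setU1 => /predU1P[->|vC].
  - exact: comparablexx.
  - exact: cmpz.
  - by rewrite comparable_sym cmpz.
  - exact: cmp.
by have := Cs z; rewrite -zC setU11 rz eqxx => /(_ isT).
Qed.

End RankedPosets.

(* An element lam of {-1, 1}^n is encoded by booleans: lam_{i+1} is
   (-1) ^+ lam i, that is, -1 when [lam i] is true and 1 otherwise. *)
Definition partial_sum (n : nat) (lam : {ffun 'I_n -> bool}) (s : nat) : int :=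
  \sum_(i < n | (i < s)%N) (-1) ^+ lam i.

(* Subsets of [1, n] are sets of ordinals s : 'I_n.+1 with s != 0. *)
Definition positive_sums (n : nat) (lam : {ffun 'I_n -> bool}) : {set 'I_n.+1} :=
  [set s : 'I_n.+1 | (0 < s)%N && (0 < partial_sum lam s)].

Definition num_neg (n : nat) (lam : {ffun 'I_n -> bool}) : nat :=
  #|[set i | lam i]|.

(* Main.v *)
(* Expanding (x^-1 - x)^n as a signed sum over +-1 walks of length n, the
   operator -U_{>=1} applied after s steps keeps exactly the walks whose s-th
   partial sum is positive.  Unfolding the recursion for t expresses t(P, x) as
   U_{>=0} of a sum over chains p_1 < ... < p_k of P \ {0}, in which -U_{>=1}
   is applied after each of the ranks rho(p_i): the truncations U_{>=0} of the
   intermediate polynomials are absorbed by the U_{>=1} that follows the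
   multiplication by x - x^-1, and [0, p) has maximal rank rho(p) - 1.  Grouping
   the chains by their rank set gives the coefficients f_S. *)
Require Import Defs.
From HB Require Import structures.
From mathcomp Require Import all_boot all_order all_algebra.
From mathcomp Require Import finmap.
From mathcomp.multinomials Require Import monalg.
From mathcomp Require Import ring zify.

Set Implicit Arguments.
Unset Strict Implicit.
Unset Printing Implicit Defensive.

Import Order.TTheory GRing.Theory Num.Theory.

Local Open Scope ring_scope.

(** * Coefficients and truncation of Laurent polynomials *)

HB.instance Definition _ (z : int) :=
  GRing.isZmodMorphism.Build laurent laurent (Ugeq z) (@UgeqB z).

Lemma mcoeff_mul_xpow (g : laurent) (k j : int) :
  (g * xpow k)@_j = g@_(j - k).
Proof.
have -> : g * xpow k = \sum_(i <- msupp g) (<< g@_i *g (i + k) >> : laurent).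
  rewrite {1}(monalgE g) mulr_suml; apply: eq_bigr => i _.
  by rewrite [LHS]laurent_mulUU mulr1.
rewrite [in RHS](monalgE g) !raddf_sum /=; apply: eq_bigr => i _.
by rewrite !mcoeffU -subr_eq0 -[in RHS]subr_eq0 opprB addrA.
Qed.

Lemma Ugeq_signM (z : int) (k : nat) (g : laurent) :
  Ugeq z ((-1) ^+ k * g) = (-1) ^+ k * Ugeq z g.
Proof. by rewrite -signr_odd !mulr_sign; case: odd; rewrite ?raddfN. Qed.

Lemma Ugeq_xpow (z k : int) : Ugeq z (xpow k) = if z <= k then xpow k else 0.
Proof.
apply/malgP => j; rewrite Ugeq_coeff /xpow mcoeffU.
have [<-|kj] := eqVneq k j; case: (z <= k);
  by rewrite ?mcoeff0 ?mcoeffU ?eqxx ?(negbTE kj) ?if_same.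
Qed.

Lemma eq_Ugeq (z : int) (g h : laurent) :
  (forall k, z <= k -> g@_k = h@_k) -> Ugeq z g = Ugeq z h.
Proof.
move=> gh; apply/malgP => k; rewrite !Ugeq_coeff.
by case: ifP => [/gh|].
Qed.

(** In degree j >= 1 the product involves only the coefficients of [g] in degrees j - 1 and j + 1,
    both nonnegative, so the inner truncation loses nothing. *)
Lemma Ugeq1_mul_Ugeq0 (g : laurent) :
  Ugeq 1 (Ugeq 0 g * (xpow 1 - xpow (-1))) = Ugeq 1 (g * (xpow 1 - xpow (-1))).
Proof.
have mcoeffM (h : laurent) (j : int) :
    (h * (xpow 1 - xpow (-1)))@_j = h@_(j - 1) - h@_(j + 1).
  by rewrite (mulrBr h) mcoeffB 2!mcoeff_mul_xpow opprK.
apply: eq_Ugeq => j j1.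
rewrite (mcoeffM (Ugeq 0 g)) (mcoeffM g) !Ugeq_coeff.
by have [-> ->] : 0 <= j - 1 /\ 0 <= j + 1 by split; lia.
Qed.

(** * Truncated products as signed sums over lattice walks *)

(* The signed sum over +-1 walks of length n whose partial sums are positive at
   the times k in s: see lattice_walksE. *)
Fixpoint lattice_walks (n : nat) (s : pred nat) : laurent :=
  if n is m.+1 then
    let g := lattice_walks m s * (xpow (-1) - xpow 1) in
    if s n then - Ugeq 1 g else g
  else 1.

Lemma eq_lattice_walks (n : nat) (s t : pred nat) :
    (forall k, (0 < k <= n)%N -> s k = t k) ->
  lattice_walks n s = lattice_walks n t.
Proof.
elim: n => [//|n IHn] st.
have E : lattice_walks n s = lattice_walks n t.
  by apply: IHn => k /andP[k0 kn]; apply: st; rewrite k0 ltnW.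
by rewrite /= E (st n.+1 (leqnn n.+1)).
Qed.

Lemma lattice_walks_tail (m n : nat) (s : pred nat) :
    (m <= n)%N -> (forall k, (m < k)%N -> s k = false) ->
  lattice_walks n s = lattice_walks m s * (xpow (-1) - xpow 1) ^+ (n - m).
Proof.
move=> /subnK <- sF; rewrite addnK; elim: (n - m)%N => [|k IHk] /=.
  by rewrite expr0 mulr1.
rewrite sF; last by rewrite ltnS leq_addl.
by rewrite IHk exprSr [RHS]mulrA.
Qed.

Section ExtendSigns.

Variable n : nat.

(** Half of the bijection that splits off the last sign of a walk, used to reindex in the induction
    of [lattice_walksE]. *)
Definition extend_signs (x : {ffun 'I_n -> bool} * bool) :
    {ffun 'I_n.+1 -> bool} :=
  [ffun i => if unlift ord_max i is Some j then x.1 j else x.2].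

Definition restrict_signs (lam : {ffun 'I_n.+1 -> bool}) :
    {ffun 'I_n -> bool} * bool :=
  ([ffun i => lam (lift ord_max i)], lam ord_max).

Lemma extend_signsK : cancel extend_signs restrict_signs.
Proof.
case=> lam b; rewrite /restrict_signs ffunE unlift_none; congr (_, _).
by apply/ffunP => i; rewrite !ffunE liftK.
Qed.

Lemma restrict_signsK : cancel restrict_signs extend_signs.
Proof.
move=> lam; apply/ffunP => i; rewrite ffunE.
by case: unliftP => [j ->|->] //=; rewrite ffunE.
Qed.

Lemma extend_signs_max x : extend_signs x ord_max = x.2.
Proof. by rewrite ffunE unlift_none. Qed.

Lemma extend_signs_widen x (i : 'I_n) :
  extend_signs x (widen_ord (leqnSn n) i) = x.1 i.
Proof.
have -> : widen_ord (leqnSn n) i = lift ord_max i.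
  by apply: val_inj; rewrite /= /bump leqNgt ltn_ord.
by rewrite ffunE liftK.
Qed.

Lemma partial_sum_extend x (k : nat) : (k <= n)%N ->
  partial_sum (extend_signs x) k = partial_sum x.1 k.
Proof.
move=> kn; rewrite /partial_sum big_mkcond big_ord_recr /= ltnNge kn addr0.
rewrite [RHS]big_mkcond; apply: eq_bigr => i _.
by rewrite extend_signs_widen.
Qed.

Lemma partial_sum_extendS x :
  partial_sum (extend_signs x) n.+1 = partial_sum x.1 n + (-1) ^+ x.2.
Proof.
rewrite /partial_sum big_mkcond big_ord_recr /= ltnSn extend_signs_max.
congr (_ + _); rewrite [RHS]big_mkcond; apply: eq_bigr => i _.
by rewrite ltnS ltn_ord ltnW ?ltn_ord // extend_signs_widen.
Qed.

End ExtendSigns.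

(** Each factor x^-1 - x is one step, an up-step costing a sign. A walk contributes a single
    monomial whose exponent is its current position, so [- Ugeq 1] keeps the walks that are positive
    at that time and costs one more sign. *)
Lemma lattice_walksE (n : nat) (s : pred nat) :
  lattice_walks n s =
  \sum_(lam : {ffun 'I_n -> bool} |
          [forall i : 'I_n, s i.+1 ==> (0 < partial_sum lam i.+1)])
    (-1) ^+ (\sum_(i < n) ~~ lam i + \sum_(i < n) s i.+1)%N
    * xpow (partial_sum lam n).
Proof.
elim: n => [|n IHn].
  rewrite /= (big_pred1 [ffun=> false]) => [|lam]; last first.
    have -> : lam = [ffun=> false] by apply/ffunP => -[].
    by rewrite /= eqxx; apply/forallP => -[].
  by rewrite !big_ord0 /partial_sum big_ord0 expr0 mul1r.
pose good (x : {ffun 'I_n -> bool} * bool) :=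
  [forall i : 'I_n, s i.+1 ==> (0 < partial_sum x.1 i.+1)].
pose term (x : {ffun 'I_n -> bool} * bool) : laurent :=
  (-1) ^+ (\sum_(i < n) ~~ x.1 i + \sum_(i < n) s i.+1 + ~~ x.2)%N
  * xpow (partial_sum x.1 n + (-1) ^+ x.2).
(* Before any truncation at time n + 1, the last sign is free: [true] selects x^-1 and [false]
   selects -x. *)
have E : lattice_walks n s * (xpow (-1) - xpow 1) = \sum_(x | good x) term x.
  rewrite IHn mulr_suml.
  (* The trivial conjunct gives the predicate the shape that [pair_big_dep] expects. *)
  under [RHS]eq_bigl => x do rewrite -[good x]andbT.
  rewrite -(pair_big_dep (fun lam => good (lam, false)) (fun _ _ => true)
             (fun lam b => term (lam, b))) /=.
  apply: eq_bigr => lam _; rewrite big_bool /term /= addn0 addn1 expr0 expr1.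
  rewrite !xpowD exprS; ring.
rewrite (reindex (@extend_signs n)); last first.
  by exists (@restrict_signs n) => x _;
    [exact: extend_signsK | exact: restrict_signsK].
have termE x : (-1) ^+ (\sum_(i < n.+1) ~~ extend_signs x i
                        + \sum_(i < n.+1) s i.+1)%N
    * xpow (partial_sum (extend_signs x) n.+1) = (-1) ^+ s n.+1 * term x.
  rewrite partial_sum_extendS /term !big_ord_recr /= extend_signs_max mulrA.
  under eq_bigr => i _ do rewrite extend_signs_widen.
  by rewrite -exprD; congr (_ ^+ _ * _); lia.
have goodE x : [forall i : 'I_n.+1, s i.+1 ==>
      (0 < partial_sum (extend_signs x) i.+1)] =
    good x && (s n.+1 ==> (0 < partial_sum x.1 n + (-1) ^+ x.2)).
  apply/forallP/andP => [H|[/forallP H Hn] i].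
    split; last by have := H ord_max; rewrite partial_sum_extendS.
    apply/forallP => i; have := H (widen_ord (leqnSn n) i).
    by rewrite /= partial_sum_extend.
  have := ltn_ord i; rewrite ltnS leq_eqVlt => /predU1P[->|lin].
    by rewrite partial_sum_extendS.
  by rewrite partial_sum_extend //; exact: (H (Ordinal lin)).
rewrite (eq_bigl _ _ goodE) (eq_bigr _ (fun x _ => termE x)) -mulr_sumr.
rewrite /= E; case: (s n.+1); last first.
  by rewrite mul1r; apply: eq_bigl => x; rewrite andbT.
(* The exponent in [term x] is the final position, so [Ugeq 1] imposes the positivity condition at
   time n + 1 term by term. *)
rewrite expr1 mulN1r; congr (- _); rewrite raddf_sum /= big_mkcondr /=.
apply: eq_bigr => x _; rewrite Ugeq_signM Ugeq_xpow gtz0_ge1.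
by case: (1 <= _); rewrite ?mulr0.
Qed.

Lemma num_negE (n : nat) (lam : {ffun 'I_n -> bool}) :
  num_neg lam = (\sum_(i < n) lam i)%N.
Proof.
rewrite /num_neg -sum1dep_card big_mkcond; apply: eq_bigr => i _.
by case: (lam i).
Qed.

Lemma sum_pos_signs (n : nat) (lam : {ffun 'I_n -> bool}) :
  (\sum_(i < n) ~~ lam i)%N = (n - num_neg lam)%N.
Proof.
have E : (\sum_(i < n) ~~ lam i + num_neg lam = n)%N.
  rewrite num_negE -big_split -[RHS]card_ord -sum1_card /=.
  by apply: eq_bigr => i _; case: (lam i).
by rewrite -(addnK (num_neg lam) (\sum_(i < n) _)%N) E.
Qed.

Lemma partial_sum_full (n : nat) (lam : {ffun 'I_n -> bool}) :
  partial_sum lam n = n%:Z - 2 * (num_neg lam)%:Z.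
Proof.
have E : n%:Z = \sum_(i < n) 1 by rewrite sumr_const card_ord natz.
rewrite /partial_sum (eq_bigl xpredT) => [|i]; last by rewrite ltn_ord.
rewrite num_negE (big_morph Posz PoszD (erefl 0%:Z)).
rewrite [X in X - _]E big_distrr -sumrB /=; apply: eq_bigr => i _.
by case: (lam i).
Qed.

(** * Chains avoiding the bottom, and the recursion for t *)

Section Chains.

Context {d : Order.disp_t} {P : finBPOrderType d}.
Variable rho : P -> nat.
Hypothesis hrho : rank_function rho.

Implicit Types (A C : {set P}) (p : P).

(** A predicate on [nat] rather than a set of ordinals, so that one chain can be used with walks of
    different lengths. *)
Definition ranks C : pred nat := [pred k | [exists u in C, rho u == k]].

Lemma ranksP C k : reflect (exists2 u, u \in C & rho u = k) (ranks C k).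
Proof.
by apply: (iffP exists_inP) => -[u uC /eqP]; exists u => //; exact/eqP.
Qed.

Definition proper_chain A C : bool := (C \subset A :\ \bot%O) && is_chain C.

Definition strict_below A p : {set P} := [set q in A | (q < p)%O].

Definition chain_top C : P :=
  odflt \bot%O [pick p in C | [forall u in C, (u <= p)%O]].

Lemma is_chainP C : reflect {in C &, forall u v, (u >=< v)%O} (is_chain C).
Proof.
apply: (iffP forall_inP) => [H u v uC vC|H u uC]; last first.
  by apply/forall_inP => v; exact: H.
by have /forall_inP := H u uC; apply.
Qed.

Lemma chain_topP C : is_chain C -> C != set0 ->
  chain_top C \in C /\ {in C, forall u, (u <= chain_top C)%O}.
Proof.
move=> /is_chainP chC /set0Pn[x0 x0C]; rewrite /chain_top.
case: pickP => [p /andP[pC /forall_inP pmax] //|none].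
(* In a chain, an element of largest rank is the greatest element, since [rho] is strictly
   increasing. *)
have [p pC pmax] := @arg_maxnP _ x0 (mem C) rho x0C.
have /= := none p; rewrite [p \in C]pC /=; case/negP; apply/forall_inP => u uC.
have /comparable_leP[//|pu] := chC u p uC pC.
by have /= := pmax u uC; rewrite leqNgt (rank_lt hrho pu).
Qed.

Lemma chain_top_eq C p : p \in C -> {in C, forall u, (u <= p)%O} ->
  chain_top C = p.
Proof.
move=> pC pmax; rewrite /chain_top; case: pickP => [q|/(_ p)].
  case/andP=> qC /forall_inP qmax; apply/eqP.
  by rewrite eq_le pmax // qmax.
by rewrite pC; case/negP; apply/forall_inP.
Qed.

(** The left-hand side is the condition that [reindex_onto] produces in [sum_proper_chain] when the
    top [p] is removed from a chain. *)
Lemma proper_chain_setU1 A C p : p \in A :\ \bot%O ->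
  [&& proper_chain A (p |: C), p |: C != set0, chain_top (p |: C) == p
    & (p |: C) :\ p == C] = proper_chain (strict_below A p) C.
Proof.
move=> pA; apply/and4P/andP => [[/andP[CA chC] C0 /eqP topC /eqP pC]|[CA chC]].
  have [_ pmax] := chain_topP chC C0; rewrite topC in pmax.
  split; last first.
    by apply/is_chainP => u v uC vC; move/is_chainP: chC; apply;
      rewrite in_setU1 ?uC ?vC orbT.
  apply/subsetP => u uC; have upC : u \in p |: C by rewrite in_setU1 uC orbT.
  have := subsetP CA u upC; rewrite !inE => /andP[-> ->] /=.
  rewrite lt_neqAle pmax // andbT.
  by move: uC; rewrite -pC in_setD1 => /andP[].
have Clt u : u \in C -> [&& u != \bot%O, u \in A & (u < p)%O].
  by move=> /(subsetP CA); rewrite !inE.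
have pmax : {in p |: C, forall u, (u <= p)%O}.
  by move=> u; rewrite in_setU1 => /predU1P[->//|/Clt/and3P[_ _ /ltW]].
split.
- apply/andP; split.
    rewrite subUset sub1set pA; apply/subsetP => u /Clt/and3P[u0 uA _].
    by rewrite !inE u0.
  apply/is_chainP => u v uC vC.
  move: (uC) (vC); rewrite !in_setU1.
  move=> /predU1P[->|uC'] /predU1P[->|vC'].
  + exact: comparablexx.
  + by rewrite /Order.comparable pmax // orbT.
  + by rewrite /Order.comparable pmax.
  + by move/is_chainP: chC; apply.
- by apply/set0Pn; exists p; rewrite setU11.
- by rewrite (chain_top_eq (setU11 _ _) pmax).
- apply/eqP/setU1K; apply/negP => /Clt/and3P[_ _].
  by rewrite ltxx.
Qed.

(** A nonempty chain is its greatest element p together with a chain strictly below p. This mirrors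
    the recursion for t, the empty chain giving its leading term. *)
Lemma sum_proper_chain (V : nmodType) (F : {set P} -> V) A :
  \sum_(C | proper_chain A C) F C =
  F set0 + \sum_(p in A :\ \bot%O)
             \sum_(C | proper_chain (strict_below A p) C) F (p |: C).
Proof.
have ch0 : proper_chain A set0.
  by rewrite /proper_chain sub0set; apply/is_chainP => u v; rewrite inE.
rewrite (bigD1 set0) //=; congr (_ + _).
rewrite (partition_big chain_top (mem (A :\ \bot%O))) /=; last first.
  move=> C /andP[/andP[CA chC] C0].
  by apply: (subsetP CA); have [] := chain_topP chC C0.
apply: eq_bigr => p pA.
rewrite (reindex_onto (fun C => p |: C) (fun C => C :\ p)) /=; last first.
  move=> C /andP[/andP[/andP[_ chC] C0] /eqP <-].
  by apply: setD1K; have [] := chain_topP chC C0.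
by apply: eq_bigl => C; rewrite -proper_chain_setU1 // -!andbA.
Qed.

Hypothesis hrho0 : rho \bot%O = 0%N.

(** Ranks grow by one along covers, so some element below [p] has rank exactly one less. *)
Lemma max_rank_strict_below A p : p \in A ->
    (forall q, (q < p)%O -> q \in A) -> p != \bot%O ->
  (\max_(q in strict_below A p) rho q)%N = (rho p).-1.
Proof.
move=> pA dA p0; have b0p : (\bot%O < p)%O by rewrite lt0x.
have rp : (0 < rho p)%N by rewrite -hrho0 rank_lt.
apply/eqP; rewrite eqn_leq; apply/andP; split.
  apply/bigmax_leqP => q; rewrite inE => /andP[_ /(rank_lt hrho)].
  by rewrite -(ltn_predK rp).
have [|z /andP[_ zp] rz] := rank_between (r := (rho p).-1) hrho (ltW b0p).
  by rewrite hrho0 leq_pred.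
have ltzp : (z < p)%O.
  rewrite lt_neqAle zp andbT; apply/eqP => ezp.
  by move: rz; rewrite ezp; lia.
by rewrite -rz (@leq_bigmax_cond _ (mem (strict_below A p))) // !inE dA.
Qed.

(** All ranks of [C] are below [rho p], so the last truncation occurs at time [rho p] and only plain
    factors follow. *)
Lemma lattice_walks_setU1 (n : nat) A C p :
    p != \bot%O -> (rho p <= n)%N -> C \subset strict_below A p ->
  lattice_walks n (ranks (p |: C)) =
  Ugeq 1 (lattice_walks (rho p).-1 (ranks C) * (xpow 1 - xpow (-1)))
    * (xpow (-1) - xpow 1) ^+ (n - rho p).
Proof.
move=> p0 pn Cp; have rp : (0 < rho p)%N by rewrite -hrho0 rank_lt ?lt0x.
have rC u : u \in C -> (rho u < rho p)%N.
  by move=> /(subsetP Cp); rewrite inE => /andP[_ /(rank_lt hrho)].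
rewrite (lattice_walks_tail pn); last first.
  move=> k pk; apply/negbTE/negP => /ranksP[u]; rewrite in_setU1.
  by case/predU1P => [->|/rC h] e; lia.
congr (_ * _); rewrite -{1}(prednK rp) /= prednK //.
have -> : ranks (p |: C) (rho p) by apply/ranksP; exists p; rewrite ?setU11.
(* The minus sign of the truncation turns x^-1 - x into the x - x^-1 of the recursion. *)
rewrite -raddfN -mulrN opprB; congr (Ugeq 1 (_ * _)).
apply: eq_lattice_walks => k /andP[k0 kp].
apply/ranksP/ranksP => [[u]|[u uC ku]]; last first.
  by exists u; rewrite // in_setU1 uC orbT.
rewrite in_setU1 => /predU1P[->|uC] ku; last by exists u.
by lia.
Qed.

(** Induction on the size of [A]. Down-closed sets include both P and the intervals [0, p) of the
    recursion, and down-closure gives [0, p) maximal rank [(rho p).-1], the walk length required by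
    [lattice_walks_setU1]. *)
Lemma short_toric_chains A : \bot%O \in A ->
    (forall p q, p \in A -> (q < p)%O -> q \in A) ->
  short_toric rho A =
  Ugeq 0 (\sum_(C | proper_chain A C)
    lattice_walks (\max_(p in A) rho p) (ranks C)).
Proof.
have [m] := ubnP #|A|; elim: m A => // m IHm A Am bA dA.
have An0 : A != set0 by apply/set0Pn; exists \bot%O.
rewrite (short_toricE _ An0) /= sum_proper_chain.
set n := (\max_(p in A) rho p)%N.
have E0 : lattice_walks n (ranks set0) = (xpow (-1) - xpow 1) ^+ n.
  rewrite (@lattice_walks_tail 0) //; first by rewrite mul1r subn0.
  by move=> k _; apply/negbTE/negP => /ranksP[u]; rewrite inE.
rewrite E0; apply: (f_equal (fun g => Ugeq 0 (_ + g))).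
apply: eq_bigr => p; rewrite in_setD1 => /andP[p0 pA].
have pn : (rho p <= n)%N by exact: (@leq_bigmax_cond _ (mem A)).
rewrite -/(strict_below A p) IHm; first last.
- move=> q r; rewrite !inE => /andP[qA qp] rq.
  by rewrite (dA q) // (lt_trans rq).
- by rewrite inE bA lt0x.
- rewrite -ltnS; apply: leq_trans Am; apply: proper_card; apply/properP; split.
    by apply/subsetP => q; rewrite inE => /andP[].
  by exists p; rewrite // inE ltxx andbF.
rewrite Ugeq1_mul_Ugeq0 max_rank_strict_below //; last by move=> q; exact: dA.
rewrite [X in Ugeq 1 X]mulr_suml raddf_sum mulr_suml.
apply: eq_bigr => C /andP[CA _].
rewrite (@lattice_walks_setU1 _ A) //.
by apply: subset_trans CA _; exact: subD1set.
Qed.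

(** * Grouping chains by rank set *)

Definition rank_set (n : nat) C : {set 'I_n.+1} :=
  [set s : 'I_n.+1 | ranks C s].

(** A chain of P_S meeting every rank of S has rank set S. Conversely, a chain with rank set S
    cannot grow inside P_S, because a chain has at most one element of each rank. *)
Lemma flag_fE (n : nat) (S : {set 'I_n.+1}) :
    S \subset [set s : 'I_n.+1 | (0 < s)%N] -> (forall p, (rho p <= n)%N) ->
  flag_f rho S = #|[set C | proper_chain [set: P] C && (rank_set n C == S)]|.
Proof.
move=> S0 rn; apply: eq_card => C; rewrite !inE.
apply/andP/andP => [[/maxsetP[/andP[CS chC] _] /forall_inP SC]|
  [/andP[CA chC] /eqP <-]].
  have rC u : u \in C -> exists2 s : 'I_n.+1, s \in S & rho u = s.
    move=> /(subsetP CS); rewrite inE => /exists_inP[s sS /eqP us].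
    by exists s.
  split.
    apply/andP; split=> //; apply/subsetP => u uC; rewrite !inE andbT.
    have [s sS us] := rC u uC; apply/eqP => u0.
    by have := subsetP S0 s sS; rewrite inE -us u0 hrho0.
  apply/eqP/setP => s; rewrite inE; apply/idP/idP => [/ranksP[u uC us]|].
    have [t tS ut] := rC u uC.
    by rewrite (_ : s = t) //; apply: val_inj; rewrite /= -us.
  by move/SC => /exists_inP[u uC /eqP us]; apply/ranksP; exists u.
split; last first.
  apply/forall_inP => s; rewrite inE => /ranksP[u uC us].
  by apply/exists_inP; exists u; rewrite ?us.
apply/maxsetP; split.
  rewrite inE chC andbT; apply/subsetP => u uC; rewrite inE; apply/exists_inP.
  have un : (rho u < n.+1)%N by rewrite ltnS.
  by exists (Ordinal un) => //; rewrite inE; apply/ranksP; exists u.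
move=> D /andP[DS /is_chainP chD] CD; apply/eqP; rewrite eqEsubset CD andbT.
apply/subsetP => u uD.
have := subsetP DS u uD; rewrite inE => /exists_inP[s].
rewrite inE => /ranksP[v vC vs] /eqP us.
suff -> : u = v by [].
(* Comparable elements of equal rank coincide. *)
have /orP[uv|vu] := chD u v uD (subsetP CD v vC); apply/eqP.
  by move: uv; rewrite le_eqVlt => /predU1P[->//|/(rank_lt hrho)];
    rewrite us vs ltnn.
by move: vu; rewrite le_eqVlt => /predU1P[->//|/(rank_lt hrho)];
    rewrite us vs ltnn.
Qed.

Lemma proper_chain_rank_set (n : nat) C :
  proper_chain [set: P] C -> rank_set n C \subset [set s : 'I_n.+1 | (0 < s)%N].
Proof.
move=> /andP[CA _]; apply/subsetP => s; rewrite !inE.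
move=> /ranksP[u uC <-]; rewrite -hrho0 rank_lt // lt0x.
by have := subsetP CA u uC; rewrite !inE => /andP[].
Qed.

(** The final position of a walk is n - 2 i_lambda. Its sign counts the n - i_lambda up-steps and
    one truncation per rank of the chain. *)
Lemma Ugeq_lattice_walks (n : nat) C : proper_chain [set: P] C ->
  Ugeq 0 (lattice_walks n (ranks C)) =
  \sum_(lam : {ffun 'I_n -> bool} |
          (rank_set n C \subset positive_sums lam)
          && (0 <= n%:Z - 2 * (num_neg lam)%:Z))
    (-1) ^+ (n - num_neg lam + #|rank_set n C|)%N
    * xpow (n%:Z - 2 * (num_neg lam)%:Z).
Proof.
move=> chC; rewrite lattice_walksE raddf_sum /= big_mkcondr /=.
(* Walk times run over 1..n while [rank_set] lives in 0..n; excluding rank 0 lets the two indexings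
   match. *)
have r0 : ranks C 0%N = false.
  apply/negbTE/negP => r0; have := subsetP (proper_chain_rank_set n chC) ord0.
  by rewrite !inE r0 => /(_ isT).
have card_rank_set : (\sum_(i < n) ranks C i.+1)%N = #|rank_set n C|.
  rewrite -sum1dep_card [RHS]big_mkcond [RHS]big_ord_recl.
  rewrite [ranks C ord0]r0 /= add0n.
  by apply: eq_bigr => i _; rewrite -[bump 0 i]/(i.+1); case: (ranks C i.+1).
have cond (lam : {ffun 'I_n -> bool}) :
    [forall i : 'I_n, ranks C i.+1 ==> (0 < partial_sum lam i.+1)] =
    (rank_set n C \subset positive_sums lam).
  apply/forallP/subsetP => [H s|H i].
    rewrite !inE; case: (unliftP ord0 s) => [i ->|->]; last by rewrite r0.
    by rewrite lift0 /=; exact/implyP.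
  apply/implyP => ri; have := H (lift ord0 i).
  by rewrite !inE lift0 => /(_ ri)/andP[].
rewrite (eq_bigl _ _ cond); apply: eq_bigr => lam _.
rewrite Ugeq_signM Ugeq_xpow sum_pos_signs card_rank_set partial_sum_full.
by case: (0 <= _); rewrite ?mulr0.
Qed.

End Chains.

Theorem proposition3p8 (d : Order.disp_t) (P : finBPOrderType d)
    (rho : P -> nat) (hrho : rank_function rho) (hrho0 : rho \bot%O = 0%N)
    (n : nat) (hn : n = (\max_(p : P) rho p)%N) :
  short_toric rho [set: P] =
  \sum_(S : {set 'I_n.+1} | S \subset [set s : 'I_n.+1 | (0 < s)%N])
    (flag_f rho S)%:R *
    \sum_(lam : {ffun 'I_n -> bool} |
            (S \subset positive_sums lam)
            && (0 <= n%:Z - 2 * (num_neg lam)%:Z))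
      (-1) ^+ (n - num_neg lam + #|S|)%N
      * xpow (n%:Z - 2 * (num_neg lam)%:Z).
Proof.
have rn p : (rho p <= n)%N by rewrite hn leq_bigmax.
rewrite short_toric_chains ?inE //; last by move=> p q; rewrite !inE.
have -> : (\max_(p in [set: P]) rho p = n)%N.
  by rewrite hn; apply: eq_bigl => p; rewrite inE.
rewrite raddf_sum /=.
rewrite (eq_bigr _ (fun C chC => Ugeq_lattice_walks hrho hrho0 n chC)).
rewrite (partition_big (rank_set rho n)
  (fun S : {set 'I_n.+1} => S \subset [set s : 'I_n.+1 | (0 < s)%N])) /=;
  last by move=> C; exact: proper_chain_rank_set.
(* The summand depends on a chain only through its rank set, so the chains over [S] contribute
   [flag_f rho S] equal terms. *)
apply: eq_bigr => S S0; rewrite flag_fE // -sum1dep_card natr_sum mulr_suml.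
by apply: eq_bigr => C /andP[_ /eqP ->]; rewrite mul1r.
Qed.
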